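(* Let $p$ and $q$ be primes such that $q\mid (p^p-1)/(p-1)$, and let $C$ be a Byott simple skew brace of order $p^pq$, with additive group $(C,+)\cong N$. Then for every $m\ge0$ there exists a finite simple skew brace $B_m$ such that $(B_m,+)\cong N^{p^m}$ and $(B_m,\circ)$ is solvable. Moreover, the braces $B_m$ may be chosen as a nested tower under diagonal subbrace embeddings, i.e. so that $B_m$ embeds diagonally as a subbrace of $B_{m+1}$ for every $m\ge0$.
   Context: A skew brace is a triple $(B,+,\circ)$ such that $(B,+)$ and $(B,\circ)$ are groups (neither assumed abelian) on the same set and $a\circ(b+c)=a\circ b-a+a\circ c$ for all $a,b,c\in B$. The two identity elements coincide and are denoted $0$. Its lambda map is $\lambda^B:(B,\circ)\to\mathrm{Aut}(B,+)$, $\lambda^B_a(b)=-a+a\circ b$. An ideal is a subgroup $I\le(B,+)$ with $I\trianglelefteq(B,+)$, $I\trianglelefteq(B,\circ)$ and $\lambda^B_a(I)=I$ for all $a\in B$. A non-zero skew brace is simple if its only ideals are $0$ and $B$. A subbrace is a subset that is a subgroup of both $(B,+)$ and $(B,\circ)$. A Byott simple skew brace of order $p^pq$ is here a simple skew brace $C$ of order $p^pq$ with the following structure: $(C,+)\cong N=V\rtimes C_q$ with $V\cong C_p^p$ (elementary abelian of order $p^p$); $(C,\circ)\cong R=C_q\rtimes P$ with $P$ a $p$-group of order $p^p$; and there are elements $X,Z\in R$ such that $X$ generates the normal subgroup $C_q$ (so $X^q=1$) and $ZX=X^pZ$. ($C_k$ denotes the cyclic group of order $k$.) ''$B_m$ embeds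 diagonally as a subbrace of $B_{m+1}$'' means that there is a group isomorphism $\psi:(B_{m+1},+)\to(B_m,+)^p$ such that $B_m\to B_{m+1}$, $a\mapsto\psi^{-1}(a,\dots,a)$, is an injective homomorphism of skew braces (respecting both $+$ and $\circ$). *)

(* Defs.v *)
From HB Require Import structures.
From mathcomp Require Import all_boot all_fingroup all_solvable.

Set Implicit Arguments.
Unset Strict Implicit.
Unset Printing Implicit Defensive.

Declare Scope brace_scope.
Delimit Scope brace_scope with B.
Local Open Scope brace_scope.

(* Both groups share the identity sb_zero: the brace law with b = c = 0 gives
   a o 0 = a, so the two identities coincide in any skew brace. *)
Record finSkewBrace := FinSkewBrace {
  sb_car :> finType;
  sb_add : sb_car -> sb_car -> sb_car;
  sb_zero : sb_car;
  sb_opp : sb_car -> sb_car;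
  sb_circ : sb_car -> sb_car -> sb_car;
  sb_cinv : sb_car -> sb_car;
  sb_addA : associative sb_add;
  sb_add0 : left_id sb_zero sb_add;
  sb_addN : left_inverse sb_zero sb_opp sb_add;
  sb_circA : associative sb_circ;
  sb_circ0 : left_id sb_zero sb_circ;
  sb_circV : left_inverse sb_zero sb_cinv sb_circ;
  sb_brace : forall a b c : sb_car,
    sb_circ a (sb_add b c) =
    sb_add (sb_add (sb_circ a b) (sb_opp a)) (sb_circ a c)
}.

Notation "0" := (sb_zero _) : brace_scope.
Notation "a + b" := (sb_add a b) : brace_scope.
Notation "- a" := (sb_opp a) : brace_scope.
Notation "a [o] b" := (sb_circ a b)
  (at level 40, left associativity) : brace_scope.

(* Aliases of the carrier of B, bearing the group structures (B, +) and (B, o);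
   MathComp writes both group laws multiplicatively. *)
Definition addG (B : finSkewBrace) : Type := sb_car B.
Definition circG (B : finSkewBrace) : Type := sb_car B.

HB.instance Definition _ (B : finSkewBrace) := Finite.on (addG B).
HB.instance Definition _ (B : finSkewBrace) :=
  Finite_isGroup.Build (addG B)
    (@sb_addA B) (@sb_add0 B) (@sb_addN B).

HB.instance Definition _ (B : finSkewBrace) := Finite.on (circG B).
HB.instance Definition _ (B : finSkewBrace) :=
  Finite_isGroup.Build (circG B)
    (@sb_circA B) (@sb_circ0 B) (@sb_circV B).

Definition sb_lambda (B : finSkewBrace) (a b : B) : B := - a + a [o] b.

(* {set addG B} and {set circG B} are convertible: the casts below only select
   which of the two group laws is used. *)
Definition is_ideal (B : finSkewBrace) (I : {set addG B}) : Prop :=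
  [/\ (group_set I)%g,
      (I <| [set: addG B])%g,
      (group_set (I : {set circG B}))%g,
      ((I : {set circG B}) <| [set: circG B])%g
    & forall a : B, [set (sb_lambda a x : addG B) | x : addG B in I] = I].

Definition simple_brace (B : finSkewBrace) : Prop :=
  (exists a : B, a <> 0) /\
  forall I : {set addG B},
    is_ideal I -> I = [set (0 : addG B)] \/ I = [set: addG B].

Definition brace_hom (B B' : finSkewBrace) (f : B -> B') : Prop :=
  (forall a b : B, f (a + b) = f a + f b) /\
  (forall a b : B, f (a [o] b) = f a [o] f b).

(* The direct power G ^ n, with the componentwise group law. *)
Definition dirpow (G : finGroupType) (n : nat) : finGroupType :=
  {dffun forall _ : 'I_n, G}.

Definition dirpow_diag (G : finGroupType) (n : nat) (a : G) : dirpow G n :=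
  [ffun=> a].

(* psi' is the inverse of the group isomorphism psi : (B', +) -> (B, +) ^ p. *)
Definition embeds_diagonally (p : nat) (B B' : finSkewBrace) : Prop :=
  exists (psi : addG B' -> dirpow (addG B) p)
         (psi' : dirpow (addG B) p -> addG B'),
    [/\ {morph psi : x y / (x * y)%g},
        cancel psi psi',
        cancel psi' psi,
        injective (fun a : B => psi' (dirpow_diag p (a : addG B)))
      & brace_hom (fun a : B => psi' (dirpow_diag p (a : addG B)) : B')].

(* N = V ><| Q with V elementary abelian of order p ^ p and Q cyclic of
   order q. *)
Definition byott_add (p q : nat) (N : finGroupType) : Prop :=
  exists V Q : {group N},
    [/\ (V ><| Q = [set: N])%g,
        (p.-abelem V)%g, #|V| = p ^ p, cyclic Q & #|Q| = q].

(* R = <[X]> ><| P with X of order q and P a p-group of order p ^ p; the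
   element Z is not required to lie in P. *)
Definition byott_circ (p q : nat) (R : finGroupType) : Prop :=
  exists (X Z : R) (P : {group R}),
    [/\ (<[X]> ><| P = [set: R])%g,
        #[X]%g = q, (p.-group P)%g, #|P| = p ^ p
      & (Z * X = X ^+ p * Z)%g].

Definition byott_simple (p q : nat) (N R : finGroupType) (C : finSkewBrace) :
    Prop :=
  [/\ simple_brace C /\ #|C| = p ^ p * q,
      ([set: addG C] \isog [set: N])%g, byott_add p q N,
      ([set: circG C] \isog [set: R])%g & byott_circ p q R].

(* Main.v *)
Require Import Defs.
From HB Require Import structures.
From mathcomp Require Import all_boot all_fingroup all_solvable all_algebra.

(* Let deg : (B, o) -> Z/p be a surjective homomorphism.  On B^p, with the
   componentwise addition, put (a o b)_i = a_i o b_(i - deg a), where deg a is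
   the sum of the degrees of the components of a.  This is a skew brace, again
   with a surjective degree, and the diagonal is a copy of B in it, because
   constant families have degree p * deg = 0.

   Suppose that B is simple and that (B, +) has trivial centre.  A non-zero ideal
   I of B^p contains the additive commutator of one of its non-zero elements with
   an element supported at a single place i, hence meets the i-th factor
   non-trivially; this intersection is an ideal of B, as one sees by acting with
   constant families.  So I contains the i-th factor and, since deg is
   surjective, all of them.  Thus B^p is simple, and the construction iterates.

   For a Byott brace C the degree comes from the p-group quotient of (C, o).  As p
   has order p modulo q, counting the fixed points of C_q on V shows that either
   (C, +) has trivial centre or it is abelian.  In the latter case its Sylow
   q-subgroup would be a proper non-zero ideal. *)

Set Implicit Arguments.
Unset Strict Implicit.
Unset Printing Implicit Defensive.

Import GRing.Theory.
Local Open Scope brace_scope.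

(** * Elementary identities and ideals of skew braces *)

Lemma sb_addr0 (B : finSkewBrace) (a : B) : a + 0 = a.
Proof. exact: (@mulg1 (addG B)). Qed.

Lemma sb_addNKr (B : finSkewBrace) (a b : B) : a + (- a + b) = b.
Proof. exact: (@mulKVg (addG B)). Qed.

Lemma sb_opp0 (B : finSkewBrace) : - 0 = 0 :> B.
Proof. exact: (@invg1 (addG B)). Qed.

Lemma sb_circr0 (B : finSkewBrace) (a : B) : a [o] 0 = a.
Proof. exact: (@mulg1 (circG B)). Qed.

Lemma sb_circE (B : finSkewBrace) (a b : B) : a [o] b = a + sb_lambda a b.
Proof. by rewrite sb_addNKr. Qed.

Lemma sb_lambdar0 (B : finSkewBrace) (a : B) : sb_lambda a 0 = 0.
Proof. by rewrite /sb_lambda sb_circr0 sb_addN. Qed.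

Lemma sb_lambdaD (B : finSkewBrace) (a b c : B) :
  sb_lambda a (b + c) = sb_lambda a b + sb_lambda a c.
Proof. by rewrite /sb_lambda sb_brace !sb_addA. Qed.

Lemma sb_lambda_inj (B : finSkewBrace) (a : B) : injective (sb_lambda a).
Proof.
move=> b c /(@mulgI (addG B)) /(@mulgI (circG B)); exact.
Qed.

(** Finiteness reduces ideals to closure conditions: a set closed under products is a subgroup, and
    an injective [sb_lambda a] mapping [I] into itself is onto [I]. Closure under the circle
    operation follows from [a [o] b = a + sb_lambda a b]. *)
Lemma is_idealP (B : finSkewBrace) (I : {set addG B}) :
  is_ideal I <->
  [/\ 0 \in I, forall a b : B, a \in I -> b \in I -> a + b \in I,
      forall a x : B, x \in I -> - a + (x + a) \in I,
      forall a x : B, x \in I -> sb_lambda a x \in I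
    & forall a x : B, x \in I -> sb_cinv a [o] (x [o] a) \in I].
Proof.
split=> [[/group_setP[I1 ID] /andP[_ nI] /group_setP[_ IM] /andP[_ nIc] lI]|].
  split=> //.
  - move=> a x Ix; have := subsetP nI a (in_setT _); rewrite inE => /subsetP.
    by apply; exact: (etrans (@memJ_conjg (addG B) I a x) Ix).
  - by move=> a x Ix; rewrite -(lI a); apply: imset_f.
  move=> a x Ix; have := subsetP nIc a (in_setT _); rewrite inE => /subsetP.
  by apply; exact: (etrans (@memJ_conjg (circG B) I a x) Ix).
case=> I0 ID nI lI nIc; split.
- by apply/group_setP; split.
- rewrite /normal subsetT; apply/subsetP=> a _; rewrite inE.
  by apply/subsetP=> _ /imsetP[x Ix ->]; apply: nI.
- apply/group_setP; split=> // a b aI bI.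
  by rewrite [(a * b)%g]sb_circE; apply: ID => //; apply: lI.
- rewrite /normal subsetT; apply/subsetP=> a _; rewrite inE.
  by apply/subsetP=> _ /imsetP[x Ix ->]; apply: nIc.
move=> a; apply/eqP; rewrite eqEcard card_imset; last exact: sb_lambda_inj.
rewrite leqnn andbT; apply/subsetP=> _ /imsetP[x Ix ->]; exact: lI.
Qed.

(** * Graded skew braces and their twisted powers *)

(** The prime p is written [n.+1], so that ['I_n.+1] carries the additive group Z/p and serves both
    as the group of degrees and as the set of places. *)
Record gradedBrace (n : nat) := GradedBrace {
  gb_brace :> finSkewBrace;
  gb_deg : gb_brace -> 'I_n.+1;
  gb_degM : forall a b : gb_brace,
    gb_deg (a [o] b) = (gb_deg a + gb_deg b)%R
}.

Lemma gb_deg0 n (B : gradedBrace n) : gb_deg (0 : B) = 0%R.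
Proof.
by apply: (addrI (gb_deg (0 : B))); rewrite -gb_degM sb_circ0 addr0.
Qed.

Lemma gb_degV n (B : gradedBrace n) (a : B) :
  gb_deg (sb_cinv a) = (- gb_deg a)%R.
Proof.
by apply/eqP; rewrite -addr_eq0 -gb_degM sb_circV gb_deg0.
Qed.

Definition tdeg n (B : gradedBrace n) (a : {ffun 'I_n.+1 -> B}) : 'I_n.+1 :=
  (\sum_i gb_deg (a i))%R.

Definition tcirc n (B : gradedBrace n) (a b : {ffun 'I_n.+1 -> B}) :
    {ffun 'I_n.+1 -> B} :=
  [ffun i => a i [o] b (i - tdeg a)%R].

Definition tcinv n (B : gradedBrace n) (a : {ffun 'I_n.+1 -> B}) :
    {ffun 'I_n.+1 -> B} :=
  [ffun i => sb_cinv (a (i + tdeg a)%R)].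

(** The shift by [tdeg a] only permutes the places, so it does not change the sum of the degrees of
    [b]. *)
Lemma tdeg_circ n (B : gradedBrace n) (a b : {ffun 'I_n.+1 -> B}) :
  tdeg (tcirc a b) = (tdeg a + tdeg b)%R.
Proof.
rewrite [X in _ = (_ + X)%R](reindex_inj (addIr (- tdeg a)%R)) -big_split.
by apply: eq_bigr => i _; rewrite ffunE gb_degM.
Qed.

Lemma tdeg_cinv n (B : gradedBrace n) (a : {ffun 'I_n.+1 -> B}) :
  tdeg (tcinv a) = (- tdeg a)%R.
Proof.
rewrite [in RHS]/tdeg (reindex_inj (addIr (tdeg a))) -sumrN.
by apply: eq_bigr => i _; rewrite ffunE gb_degV.
Qed.

Lemma tcircA n (B : gradedBrace n) : associative (@tcirc n B).
Proof.
move=> a b c; apply/ffunP=> i.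
by rewrite !ffunE tdeg_circ opprD addrA sb_circA.
Qed.

Lemma tdeg_const n (B : gradedBrace n) (a : B) :
  tdeg [ffun=> a] = 0%R.
Proof.
rewrite /tdeg (eq_bigr (fun=> gb_deg a)) => [|i _]; last by rewrite ffunE.
by rewrite sumr_const card_ord Zp_mulrn; apply: val_inj; rewrite /= modnMl.
Qed.

Lemma tcirc0 n (B : gradedBrace n) : left_id [ffun=> (0 : B)] (@tcirc n B).
Proof.
by move=> a; apply/ffunP=> i; rewrite !ffunE tdeg_const subr0 sb_circ0.
Qed.

Lemma tcircV n (B : gradedBrace n) :
  left_inverse [ffun=> (0 : B)] (@tcinv n B) (@tcirc n B).
Proof.
by move=> a; apply/ffunP=> i; rewrite !ffunE tdeg_cinv opprK sb_circV.
Qed.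

(** The shift depends on [a] alone and is the same in all three circle products, so each coordinate
    is an instance of the brace law of [B]. *)
Lemma tbrace n (B : gradedBrace n) (a b c : dirpow (addG B) n.+1) :
  tcirc a (b * c)%g =
  ((tcirc a b : dirpow (addG B) n.+1) * a^-1 * tcirc a c)%g.
Proof. by apply/ffunP=> i; rewrite !ffunE; apply: sb_brace. Qed.

(** The additive structure is that of [dirpow (addG B) n.+1] itself, so the isomorphism with the
    direct power is the identity map. *)
Definition tpower n (B : gradedBrace n) : finSkewBrace :=
  @FinSkewBrace {ffun 'I_n.+1 -> B} _ _ _ _ _
    (@mulgA (dirpow (addG B) n.+1)) (@mul1g (dirpow (addG B) n.+1))
    (@mulVg (dirpow (addG B) n.+1)) (@tcircA n B) (@tcirc0 n B) (@tcircV n B)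
    (@tbrace n B).

Definition gtpower n (B : gradedBrace n) : gradedBrace n :=
  @GradedBrace n (tpower B) (@tdeg n B) (@tdeg_circ n B).

(** Shifting a constant family does nothing, so the twist is invisible on the diagonal. *)
Lemma embeds_tpower n (B : gradedBrace n) :
  embeds_diagonally n.+1 B (gtpower B).
Proof.
exists id, id; split=> //.
  by move=> a b /ffunP /(_ 0%R); rewrite !ffunE.
split=> a b; apply/ffunP=> i; rewrite !ffunE //.
Qed.

(** * Simplicity of the twisted power *)

Definition centerless (B : finSkewBrace) : Prop :=
  forall z : B, (forall a : B, a + z = z + a) -> z = 0.

Definition single n (B : finSkewBrace) (i : 'I_n) (a : B) : {ffun 'I_n -> B} :=
  [ffun j => if j == i then a else 0].

Lemma tpowerDE n (B : gradedBrace n) (a b : tpower B) i :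
  (a + b) i = a i + b i.
Proof. exact: ffunE. Qed.

Lemma tpowerNE n (B : gradedBrace n) (a : tpower B) i : (- a) i = - a i.
Proof. exact: ffunE. Qed.

Lemma tpowerME n (B : gradedBrace n) (a b : tpower B) i :
  (a [o] b) i = a i [o] b (i - tdeg a)%R.
Proof. exact: ffunE. Qed.

Lemma tpower0E n (B : gradedBrace n) i : (0 : tpower B) i = 0.
Proof. exact: ffunE. Qed.

Definition tpowerE := (tpowerDE, tpowerNE, tpowerME, tpower0E).

Lemma singleD n (B : gradedBrace n) (i : 'I_n.+1) (a b : B) :
  single i (a + b) = (single i a : tpower B) + single i b.
Proof.
by apply/ffunP=> j; rewrite tpowerDE !ffunE; case: eqP; rewrite ?sb_add0.
Qed.

Lemma single0 n (B : gradedBrace n) (i : 'I_n.+1) :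
  single i (0 : B) = (0 : tpower B).
Proof. by apply/ffunP=> j; rewrite tpowerE ffunE if_same. Qed.

Lemma single_inj n (B : finSkewBrace) (i : 'I_n) : injective (@single n B i).
Proof. by move=> a b /ffunP/(_ i); rewrite !ffunE eqxx. Qed.

Lemma tdeg_single n (B : gradedBrace n) (i : 'I_n.+1) (a : B) :
  tdeg (single i a) = gb_deg a.
Proof.
rewrite /tdeg (bigD1 i) //= big1 ?addr0 => [|j /negPf ji].
  by rewrite ffunE eqxx.
by rewrite ffunE ji gb_deg0.
Qed.

(** The lambda action permutes the factors according to the degree; this is what carries one factor
    into another. *)
Lemma lambda_single n (B : gradedBrace n) (c : tpower B) (i : 'I_n.+1) (a : B) :
  sb_lambda c (single i a : tpower B) =
  single (i + tdeg c)%R (sb_lambda (c (i + tdeg c)%R) a).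
Proof.
apply/ffunP=> j; rewrite /sb_lambda !tpowerE !ffunE subr_eq.
by case: eqP => [->|] //; rewrite sb_circr0 sb_addN.
Qed.

(** The degree of [single i x] may be non-zero, but it only shifts the constant family [c]; and [c]
    has degree 0, so place [i] is kept. *)
Lemma conj_single n (B : gradedBrace n) (i : 'I_n.+1) (a x : B) :
  let c : tpower B := [ffun=> a] in
  sb_cinv c [o] ((single i x : tpower B) [o] c) =
  single i (sb_cinv a [o] (x [o] a)).
Proof.
apply/ffunP=> j; rewrite !tpowerE !ffunE.
rewrite [X in (_ - X)%R]tdeg_cinv tdeg_const opprK addr0.
by case: eqP => //; rewrite sb_circ0 sb_circV.
Qed.

Lemma conj_add_single n (B : gradedBrace n) (i : 'I_n.+1) (a x : B) :
  let c : tpower B := single i a in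
  - c + ((single i x : tpower B) + c) = single i (- a + (x + a)).
Proof.
apply/ffunP=> j; rewrite !tpowerE !ffunE.
by case: eqP => //; rewrite sb_add0 sb_addN.
Qed.

Lemma commutator_single n (B : gradedBrace n) (i : 'I_n.+1) (x : tpower B)
    (a : B) :
  let c : tpower B := single i a in
  - c + (- x + c) + x = single i (- a + (- x i + a) + x i).
Proof.
apply/ffunP=> j; rewrite !tpowerE !ffunE.
by case: eqP => [->|] //; rewrite sb_opp0 sb_add0 sb_addr0 sb_addN.
Qed.

Lemma is_idealN (B : finSkewBrace) (I : {set addG B}) (x : B) :
  is_ideal I -> x \in I -> - x \in I.
Proof. by case=> gI _ _ _ _; apply: (@groupVr (addG B) (Group gI)). Qed.

(** The lambda action and circle conjugation of [B] are realised at place [i] by constant families,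
    additive conjugation by elements supported at [i]. *)
Lemma tpower_fiber_ideal n (B : gradedBrace n) (I : {set addG (tpower B)})
    (i : 'I_n.+1) :
  is_ideal I -> is_ideal [set a : addG B | single i a \in I].
Proof.
case/is_idealP=> I0 ID nI lI nIc; set J := [set a | _].
have JE (a : B) : (a \in J) = (single i a \in I) by exact: in_set.
apply/is_idealP; split.
- by rewrite JE single0.
- by move=> a b; rewrite !JE singleD; apply: ID.
- by move=> a x; rewrite !JE -conj_add_single; apply: nI.
- move=> a x; rewrite !JE => /(lI [ffun=> a]).
  by rewrite lambda_single tdeg_const addr0 ffunE.
by move=> a x; rewrite !JE -conj_single; apply: nIc.
Qed.

Lemma tpower_add_closed n (B : gradedBrace n) (I : {set addG (tpower B)}) :
  (0 : tpower B) \in I ->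
  (forall a b : tpower B, a \in I -> b \in I -> a + b \in I) ->
  (forall i a, single i a \in I) -> I = [set: addG (tpower B)].
Proof.
move=> I0 ID sI; apply/setP=> x; rewrite inE.
(* [t k] keeps the first [k] coordinates of [x]; induction on [k] adds one place at a time. *)
pose t k : tpower B := [ffun i : 'I_n.+1 => if i < k then x i else 0].
have tE k i : t k i = if i < k then x i else 0 by exact: ffunE.
have tI k : k <= n.+1 -> t k \in I.
  elim: k => [|k IHk] kn.
    by have -> : t 0%N = 0; last by []; apply/ffunP=> i; rewrite tE.
  have -> : t k.+1 = t k + single (Ordinal kn) (x (Ordinal kn)).
    apply/ffunP=> i; rewrite tpowerDE !tE ffunE ltnS leq_eqVlt -val_eqE /=.
    case: ltngtP => [||ik]; rewrite ?sb_addr0 ?sb_add0 //.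
    by congr (x _); apply: val_inj.
  by apply: ID => //; apply: IHk; apply: ltnW.
have <- : t n.+1 = x by apply/ffunP=> i; rewrite tE ltn_ord.
exact: tI.
Qed.

Lemma tpower_simple n (B : gradedBrace n) :
  simple_brace B -> centerless B -> (forall k, exists a : B, gb_deg a = k) ->
  simple_brace (tpower B).
Proof.
move=> [[a0 a0n] sB] cB dB; split.
  by exists (single 0%R a0); rewrite -(single0 B 0%R) => /single_inj.
move=> I idI; have [I0 ID nI lI nIc] := (is_idealP I).1 idI.
have fib i :
    (forall a, single i a \in I -> a = 0) \/ (forall a, single i a \in I).
  have [/setP J|/setP J] := sB _ (tpower_fiber_ideal i idI).
    by left=> a; have := J a; rewrite !inE => -> /eqP.
  by right=> a; have := J a; rewrite !inE.
have [Itriv|[x xI xn]] :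
    (forall x, x \in I -> x = 0) \/ exists2 x, x \in I & x != 0.
  have [/existsP[x /andP[]]|/existsPn nx] := boolP [exists x in I, x != 0].
    by right; exists x.
  by left=> x xI; apply/eqP; have := nx x; rewrite xI /= negbK.
  left; apply/setP=> x; rewrite inE; apply/idP/eqP=> [/Itriv //|-> //].
right; apply: tpower_add_closed => // j.
have [i xi] : exists i, x i != 0.
  apply/existsP; apply: contraR xn => /existsPn h.
  by apply/eqP/ffunP=> i; rewrite tpowerE; have := h i; rewrite negbK => /eqP.
have full_i : forall a, single i a \in I.
  (* If the fibre at [i] is trivial, all commutators of [x] with elements supported at [i] vanish,
     which makes [x i] central, hence 0. *)
  have [triv|//] := fib i; case/eqP: xi; apply: cB => a.
  have /triv : single i (- a + (- x i + a) + x i) \in I.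
    by rewrite -commutator_single; apply: ID => //; apply: nI; apply: is_idealN.
  move/(congr1 (fun y => x i + (a + y))).
  by rewrite sb_addr0 -sb_addA sb_addNKr -sb_addA sb_addNKr.
(* An element of degree [j - i] moves the non-zero [single i a0] to place [j], so the fibre there
   cannot be trivial. *)
have [triv|//] := fib j; have [b bj] := dB (j - i)%R.
have := lI (single 0%R b) _ (full_i a0).
rewrite lambda_single tdeg_single bj addrC subrK => /triv.
by rewrite -(sb_lambdar0 (single 0%R b j)) => /sb_lambda_inj.
Qed.

Lemma tpower_centerless n (B : gradedBrace n) :
  centerless B -> centerless (tpower B).
Proof.
move=> cB z cz; apply/ffunP=> i; rewrite tpowerE; apply: cB => a.
by have /ffunP/(_ i) := cz (single i a); rewrite !tpowerE !ffunE eqxx.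
Qed.

Lemma tdeg_surj n (B : gradedBrace n) :
  (forall k, exists a : B, gb_deg a = k) ->
  forall k, exists a : gtpower B, gb_deg a = k.
Proof.
move=> dB k; have [a <-] := dB k; exists (single 0%R a).
exact: tdeg_single.
Qed.

(** * Solvability of the circle group of the twisted power *)

Section Solvable.
Local Open Scope group_scope.

(* A perfect subgroup of the power has degree 0 because the degrees form an
   abelian group, and on elements of degree 0 the coordinates are morphisms. *)
Lemma tpower_solvable n (B : gradedBrace n) :
  solvable [set: circG B] -> solvable [set: circG (tpower B)].
Proof.
move=> solB; apply/forall_inP=> H; rewrite subsetI => /andP[_ HH].
have degM : {in H &,
    {morph (fun a : circG (tpower B) => tdeg a) : x y / x * y >-> x * y}}.
  by move=> a b _ _; apply: tdeg_circ.
have deg0 a : a \in H -> tdeg (a : tpower B) = 0%R.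
  move=> aH; have := mem_morphim (Morphism degM) aH (subsetP HH _ aH).
  rewrite morphimR // (commG1P _) => [/set1P //|].
  by apply: (sub_abelian_cent2 (Zp_abelian _)); apply: subsetT.
apply/eqP/trivgP/subsetP=> a aH; rewrite inE; apply/eqP/ffunP=> i.
have prM : {in H &,
    {morph (fun a : circG (tpower B) => a i : circG B) : x y / x * y >-> x * y}}.
  by move=> x y Hx Hy; rewrite [LHS]tpowerME (deg0 x) // subr0.
have /implyP/(_ _)/eqP := forallP solB (Morphism prM @* H)%G.
rewrite subsetI subsetT -morphimR // => /(_ (morphimS _ HH)) /setP /(_ (a i)).
rewrite tpowerE inE (mem_morphim (Morphism prM) aH aH).
by move/esym/eqP.
Qed.
End Solvable.

(** * Isomorphisms between direct powers of groups *)

Section DirectPowers.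
Local Open Scope group_scope.

Lemma isog_bij (G H : finGroupType) (f : G -> H) :
  {morph f : x y / x * y} -> bijective f -> [set: G] \isog [set: H].
Proof.
move=> fM [g fK gK]; have fMT : {in [set: G] &, {morph f : x y / x * y}}.
  by move=> x y _ _; apply: fM.
apply/isogP; exists (Morphism fMT).
  by apply/injmP=> x y _ _; apply: can_inj fK x y.
by apply/setP=> y; rewrite in_setT -(gK y)
  (mem_morphim (Morphism fMT)) ?in_setT.
Qed.

Lemma isog_setT_bij (G H : finGroupType) :
  [set: G] \isog [set: H] ->
  exists2 f : G -> H, {morph f : x y / x * y} & bijective f.
Proof.
move=> isoGH; have/isogP[f injf imf] := isoGH; exists f.
  by move=> x y; rewrite morphM ?inE.
apply: inj_card_bij; first by move=> x y; apply: (injmP injf); rewrite inE.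
by rewrite -!cardsT (card_isog isoGH).
Qed.

Lemma dirpow_isog (G H : finGroupType) (n : nat) :
  [set: G] \isog [set: H] -> [set: dirpow G n] \isog [set: dirpow H n].
Proof.
case/isog_setT_bij=> f fM [g fK gK].
apply: (@isog_bij (dirpow G n) (dirpow H n) (fun u => [ffun i => f (u i)])).
  by move=> u v; apply/ffunP=> i; rewrite !ffunE fM.
exists (fun u : dirpow H n => [ffun i => g (u i)] : dirpow G n);
  by move=> u; apply/ffunP=> i; rewrite !ffunE.
Qed.

Lemma dirpow_dirpow_isog (G : finGroupType) (m n : nat) :
  [set: dirpow (dirpow G m) n] \isog [set: dirpow G (n * m)].
Proof.
have cnm : #|{: 'I_n * 'I_m}| = (n * m)%N by rewrite card_prod !card_ord.
(* Any bijection between the two index sets will do; [f] and [h] come from the enumeration of the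
   pairs. *)
pose f (i : 'I_(n * m)) : 'I_n * 'I_m := enum_val (cast_ord (esym cnm) i).
pose h x : 'I_(n * m) := cast_ord cnm (enum_rank x).
have fK : cancel f h by move=> i; rewrite /h /f enum_valK cast_ordKV.
have hK : cancel h f by move=> x; rewrite /h /f cast_ordK enum_rankK.
apply: (@isog_bij (dirpow (dirpow G m) n) (dirpow G (n * m))
  (fun u => [ffun i => u (f i).1 (f i).2])).
  by move=> u v; apply/ffunP=> i; rewrite !ffunE.
exists (fun u : dirpow G (n * m) =>
  [ffun i => [ffun j => u (h (i, j))] : dirpow G m]).
  by move=> u; apply/ffunP=> i; apply/ffunP=> j; rewrite !ffunE hK.
by move=> u; apply/ffunP=> i; rewrite !ffunE -surjective_pairing fK.
Qed.

Lemma dirpow1_isog (G : finGroupType) : [set: G] \isog [set: dirpow G 1].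
Proof.
apply: (@isog_bij G (dirpow G 1) (fun a => [ffun=> a])).
  by move=> a b; apply/ffunP=> i; rewrite !ffunE.
exists (fun u : dirpow G 1 => u ord0) => [a|u]; first by rewrite ffunE.
by apply/ffunP=> i; rewrite ffunE [i]ord1.
Qed.

End DirectPowers.

(** * Arithmetic and group theory of Byott braces *)

Section Byott.
Local Open Scope group_scope.

(** This expresses that p has order exactly p modulo q, in the form used below to read off the size
    of a fixed-point group. *)
Lemma byott_primes (p q : nat) :
  prime p -> prime q -> (q %| (p ^ p - 1) %/ (p - 1))%N ->
  (p ^ p = 1 %[mod q])%N /\
  forall k, (k < p)%N -> (p ^ k = 1 %[mod q])%N -> k = 0%N.
Proof.
move=> pp pq; rewrite !subn1 predn_exp mulKn -?subn1 ?subn_gt0 ?prime_gt1 //.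
move=> qs; have p0 := prime_gt0 pp.
have pp1 : (p ^ p = 1 %[mod q])%N.
  apply/eqP; rewrite eqn_mod_dvd ?expn_gt0 ?p0 // subn1 predn_exp.
  exact: dvdn_mull.
split=> // k kp pk1; apply/eqP; rewrite -leqn0 leqNgt; apply/negP=> k0.
have p1 : (p = 1 %[mod q])%N.
  (* As [0 < k < p] with p prime, Bezout writes 1 through [k] and [p], so the two congruences force
     p to be 1 modulo q. *)
  have [u [v uv]] : exists u v, (u * k = v * p + 1)%N.
    have [u v uv _] := egcdnP p k0; exists u, v; rewrite uv; congr (_ + _)%N.
    apply/eqP; rewrite -/(coprime k p) coprime_sym prime_coprime //.
    by apply/negP=> /(dvdn_leq k0); rewrite leqNgt kp.
  have : (p ^ (u * k) = p ^ (v * p + 1) %[mod q])%N by rewrite uv.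
  rewrite expnD expn1 mulnC -modnMml (mulnC v) !expnM.
  by rewrite -modnXm pk1 modnXm exp1n
    -[in X in _ = X]modnXm pp1 modnXm exp1n modnMml mul1n.
(* The geometric sum is divisible by q and congruent to p, so q = p, which contradicts [p1]. *)
have : (\sum_(i < p) p ^ i = p %[mod q])%N.
  rewrite -modn_summ (eq_bigr (fun=> 1 %% q)%N) => [|i _].
    by rewrite modn_summ sum1_card card_ord.
  by rewrite -modnXm p1 modnXm exp1n.
rewrite (eqP qs) => /esym/eqP; rewrite -/(dvdn q p) dvdn_prime2 // => /eqP qp.
by move: p1; rewrite qp modnn modn_small ?prime_gt1.
Qed.

Lemma byott_add_isog (p q : nat) (G H : finGroupType) :
  [set: G] \isog [set: H] -> byott_add p q G -> byott_add p q H.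
Proof.
case/isogP=> f injf imf [V [Q [dG aV cV cQ oQ]]].
exists (f @* V)%G, (f @* Q)%G; split.
- by rewrite -imf; apply: injm_sdprod.
- exact: morphim_abelem.
- by rewrite card_injm ?subsetT.
- exact: morphim_cyclic.
by rewrite card_injm ?subsetT.
Qed.

(** The fixed points of [Q] in [V] number [p ^ k], congruent to [#|V|] and so to 1 modulo q; hence
    [k] is 0 or p. If [k = p], then [Q] centralises [V]; if [k = 0], a central element is shown to
    be trivial. *)
Lemma byott_add_center (p q : nat) (G : finGroupType) :
  prime p -> prime q -> (q %| (p ^ p - 1) %/ (p - 1))%N ->
  byott_add p q G -> abelian [set: G] \/ 'Z([set: G]) = 1.
Proof.
move=> pp pq qd [V [Q [dG aV cV cQ oQ]]].
have [pp1 ord_p] := byott_primes pp pq qd.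
have [nsV _ defG nVQ _] := sdprod_context dG.
have pV := abelem_pgroup aV.
have [k kp ck] : exists2 k, (k <= p)%N & #|'C_V(Q)| = (p ^ k)%N.
  by apply/(dvdn_pfactor _ _ pp); rewrite -cV cardSg ?subsetIl.
have: #|V| = #|'Fix_(V | 'J)(Q)| %[mod q].
  by apply: pgroup_fix_mod; rewrite ?astabsJ // /pgroup oQ pnat_id.
rewrite afixJ cV ck pp1 => /esym pk1.
have [kp'|pk] := ltnP k p; last first.
  left; have kE : k = p by apply/eqP; rewrite eqn_leq kp.
  have /setIidPl : 'C_V(Q) = V.
    by apply/eqP; rewrite eqEcard subsetIl cV ck kE leqnn.
  by move=> VQ; rewrite -defG abelianM (abelem_abelian aV)
    cyclic_abelian // centsC.
right; have CV1 : 'C_V(Q) = 1.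
  by apply/eqP; rewrite trivg_card1 ck (ord_p k).
apply/trivgP/subsetP=> z /centerP[_ zc].
have /mulsgP[v x vV xQ zE] : z \in V * Q by rewrite defG inE.
(* [v] is the product of the central [z] and an element of the abelian [Q], so it lies in the
   trivial group ['C_V(Q)]. *)
have v1 : v = 1.
  suff: v \in 'C_V(Q) by rewrite CV1 => /set1P.
  rewrite inE vV; apply/centP=> y yQ.
  have -> : v = z * x^-1 by rewrite zE mulgK.
  apply/commute_sym/commuteM; first by apply/commute_sym/zc; rewrite inE.
  by apply/commuteV/(centsP (cyclic_abelian cQ)).
rewrite v1 mul1g in zE; rewrite zE inE; apply: contraT => x1.
(* A non-trivial central [x] in [Q] would generate [Q], of prime order; then [Q] would centralise
   [V] and [V] would be trivial. *)
have Qx : <[x]> = Q.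
  apply/eqP; rewrite eqEcard cycle_subG xQ oQ; apply/eq_leq/esym.
  by apply/(prime_nt_dvdP pq); rewrite ?order_eq1 // -oQ order_dvdG.
have : 'C_V(Q) = V.
  apply/setIidPl/centsP=> u uV y; rewrite -Qx => /cycleP[j ->].
  by apply: commuteX; rewrite -zE; apply: commute_sym; apply: zc; rewrite inE.
rewrite CV1 => V1; move: cV; rewrite -V1 cards1 => /esym/eqP.
by rewrite -(expn0 p) eqn_exp2l ?prime_gt1 // => /eqP p0; rewrite p0 in pp.
Qed.

Lemma byott_coprime (p q : nat) :
  prime p -> prime q -> (q %| (p ^ p - 1) %/ (p - 1))%N -> coprime q p.
Proof.
move=> pp pq qd; rewrite prime_coprime // dvdn_prime2 //; apply/eqP=> qp.
have [pp1 _] := byott_primes pp pq qd; move: pp1; rewrite qp -modnXm modnn.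
by rewrite exp0n ?prime_gt0 // mod0n modn_small ?prime_gt1.
Qed.

Lemma byott_circ_normal (p q : nat) (G H : finGroupType) :
  [set: G] \isog [set: H] -> byott_circ p q G ->
  exists X : {group H},
    [/\ X <| [set: H], #|X| = q & #|[set: H]| = (p ^ p * q)%N].
Proof.
case/isogP=> f injf imf [x [_ [P [dG oX _ cP _]]]].
exists (f @* <[x]>)%G; split.
- have [nX _ _ _ _] := sdprod_context dG.
  by rewrite -imf; apply: morphim_normal.
- by rewrite card_injm ?subsetT.
by rewrite -imf card_injm ?subsetT // -(sdprod_card dG) mulnC cP -oX.
Qed.

(** The quotient by [X] is a p-group, non-trivial because the exponent is [k.+1]; a maximal subgroup
    of it is normal of index p, and the quotient by that is Z/p. *)
Lemma normal_pindex_surj (n k : nat) (G : finGroupType) (X : {group G}) :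
  prime n.+1 -> X <| [set: G] -> #|[set: G] : X| = (n.+1 ^ k.+1)%N ->
  exists2 d : G -> 'I_n.+1, {morph d : a b / a * b >-> (a + b)%R} &
    forall i, exists a, d a = i.
Proof.
move=> pp nX iX.
have cQ : #|[set: G] / X| = (n.+1 ^ k.+1)%N.
  by rewrite card_quotient ?normal_norm.
have pQ : (n.+1).-group ([set: G] / X) by rewrite /pgroup cQ pnatX pnat_id.
have [/esym Q1|[M maxM _]] := maximal_exists (sub1G ([set: G] / X)).
  move: cQ; rewrite Q1 cards1 => /esym/eqP; rewrite -(expn0 n.+1).
  by rewrite eqn_exp2l ?prime_gt1.
have nM := p_maximal_normal pQ maxM.
have cM : #|([set: G] / X) / M| = n.+1.
  by rewrite card_quotient ?normal_norm // (p_maximal_index pQ maxM).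
have : ([set: G] / X) / M \isog [set: 'I_n.+1].
  have cI : #|[set: 'I_n.+1]| = n.+1 by rewrite cardsT card_ord.
  by rewrite isog_cyclic_card ?cM ?cI ?eqxx ?andbT;
     apply: prime_cyclic; rewrite ?cM ?cI.
case/isogP=> f injf imf.
have inM a : coset M (coset X a) \in ([set: G] / X) / M.
  rewrite !mem_quotient ?inE //.
exists (fun a => f (coset M (coset X a))).
  move=> a b; have nXa c : c \in 'N(X).
    by rewrite (subsetP (normal_norm nX)) ?inE.
  have nMa c : coset X c \in 'N(M).
    by rewrite (subsetP (normal_norm nM)) ?mem_quotient ?inE.
  by rewrite -[RHS]/(_ * _) -morphM // !coset_morphM.
move=> i; have: i \in f @* ([set: G] / X / M) by rewrite imf inE.
case/morphimP=> _ _ /morphimP[_ _ /morphimP[a _ _ ->] ->] ->.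
by exists a.
Qed.

(** Packaged for [Morphism], so that general facts on images of q-elements apply to
    [sb_lambda a]. *)
Definition lambda_morphM (B : finSkewBrace) (a : B) :
  {in [set: addG B] &, {morph (sb_lambda a : addG B -> addG B) : b c / b * c}}
  := fun b c _ _ => sb_lambdaD a b c.

(* If (C, +) were abelian, its Sylow q-subgroup would be a left ideal; as a
   subgroup of order q of (C, o), it would be the normal subgroup <[X]>, hence
   an ideal. *)
Lemma byott_simple_nonabelian (p q : nat) (N R : finGroupType)
    (C : finSkewBrace) :
  prime p -> prime q -> (q %| (p ^ p - 1) %/ (p - 1))%N ->
  byott_simple p q N R C -> ~~ abelian [set: addG C].
Proof.
move=> pp pq qd [[[_ sC] _] isoN bN isoR bR]; apply/negP=> abC.
have qp := byott_coprime pp pq qd.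
have [V [Q [dG _ cV _ oQ]]] := byott_add_isog (isog_symr isoN) bN.
have [X [nX oX cR]] := byott_circ_normal (isog_symr isoR) bR.
have [_ _ defG _ _] := sdprod_context dG.
have nQ : Q <| [set: addG C] by rewrite -sub_abelian_normal ?subsetT.
have hQ : q.-Hall([set: addG C]) Q.
  rewrite /pHall subsetT /pgroup oQ pnat_id //= -divgS ?subsetT // oQ.
  by rewrite -(sdprod_card dG) cV oQ mulnK ?prime_gt0 //
    p'natE // -prime_coprime // coprimeXr.
have hX : q.-Hall([set: circG C]) X.
  rewrite /pHall subsetT /pgroup oX pnat_id //= -divgS ?subsetT // oX.
  by rewrite cR mulnK ?prime_gt0 //
    p'natE // -prime_coprime // coprimeXr.
have QL (a x : C) :
    x \in (Q : {set addG C}) -> sb_lambda a x \in (Q : {set addG C}).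
  (* A normal Sylow q-subgroup is the set of all q-elements, which every additive endomorphism
     preserves. *)
  have QE (y : addG C) : (y \in Q) = q.-elt y.
    by apply: (mem_normal_Hall hQ nQ); rewrite inE.
  move=> xQ; apply: (etrans (QE _)).
  apply: (morph_p_elt (Morphism (@lambda_morphM C a))); first by rewrite inE.
  by rewrite -QE.
have gQ : group_set (Q : {set circG C}).
  apply/group_setP; split; first exact: (group1 Q).
  move=> x y xQ yQ; rewrite [(x * y)%g]sb_circE.
  by apply: (@groupM (addG C) Q) => //; apply: QL.
have QX : (Q : {set circG C}) = X.
  apply/eqP; rewrite eqEcard oX (eq_leq (esym oQ)) andbT.
  rewrite -[Q : {set circG C}]/(gval (Group gQ)).
  by rewrite (sub_normal_Hall hX) ?subsetT // /pgroup [#|_|]oQ pnat_id.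
have idQ : is_ideal Q.
  apply/is_idealP; split=> //.
  - exact: (@group1 (addG C) Q).
  - exact: (@groupM (addG C) Q).
  - move=> a x xQ; have := subsetP (normal_norm nQ) a (in_setT _).
    rewrite inE => /subsetP; apply.
    exact: (etrans (@memJ_conjg (addG C) Q a x) xQ).
  move=> a x; rewrite QX => xQ; have := subsetP (normal_norm nX) a (in_setT _).
  rewrite inE => /subsetP; apply.
  exact: (etrans (@memJ_conjg (circG C) X a x) xQ).
case: (sC _ idQ) => [Q0|QT].
  by move: oQ; rewrite Q0 cards1 => q1; rewrite -q1 in pq.
have cq : q = (p ^ p * q)%N by rewrite -[LHS]oQ QT -(sdprod_card dG) cV oQ.
have : (q < p ^ p * q)%N.
  by rewrite ltn_Pmull ?prime_gt0 // -(exp1n p) ltn_exp2r ?prime_gt0 ?prime_gt1.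
by rewrite -cq ltnn.
Qed.

End Byott.

(** * The tower of simple braces over a Byott brace *)

Lemma addG_tpower_isog n (B : gradedBrace n) :
  ([set: addG (tpower B)] \isog [set: dirpow (addG B) n.+1])%g.
Proof.
apply: (@isog_bij (addG (tpower B)) (dirpow (addG B) n.+1) id) => //.
by exists id.
Qed.

Lemma byott_simple_centerless (p q : nat) (N R : finGroupType)
    (C : finSkewBrace) :
  prime p -> prime q -> q %| (p ^ p - 1) %/ (p - 1) ->
  byott_simple p q N R C -> centerless C.
Proof.
move=> pp pq qd bC z zc; have nab := byott_simple_nonabelian pp pq qd bC.
have [_ isoN bN _ _] := bC.
have bC' := byott_add_isog (isog_symr isoN) bN.
have [/idPn//|Z1] := byott_add_center pp pq qd bC'.
have : (z : addG C) \in ('Z([set: addG C]))%g.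
  by apply/centerP; split=> [|a _]; [rewrite inE | apply/esym/zc].
by rewrite Z1 => /set1gP.
Qed.

Lemma byott_simple_degree (n q : nat) (N R : finGroupType) (C : finSkewBrace) :
  prime n.+1 -> prime q -> byott_simple n.+1 q N R C ->
  exists2 d : C -> 'I_n.+1, (forall a b, d (a [o] b) = (d a + d b)%R) &
    forall i, exists a, d a = i.
Proof.
move=> pp pq [_ _ _ isoR bR].
have [X [nX oX cR]] := byott_circ_normal (isog_symr isoR) bR.
apply: (@normal_pindex_surj n n (circG C) X) => //.
by rewrite -divgS ?subsetT // oX cR mulnK ?prime_gt0.
Qed.

(** The circle group is an extension of a p-group by a cyclic group. *)
Lemma byott_simple_solvable (p q : nat) (N R : finGroupType)
    (C : finSkewBrace) :
  prime q -> byott_simple p q N R C -> solvable [set: circG C].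
Proof.
move=> pq [_ _ _ isoR [X [Z [P [dR oX pP _ _]]]]].
have [nX _ _ _ _] := sdprod_context dR.
rewrite (isog_sol isoR) (series_sol nX) abelian_sol ?cycle_abelian //.
by rewrite -(isog_sol (sdprod_isog dR)) (pgroup_sol pP).
Qed.

Theorem corollary5p3 (p q : nat) (N R : finGroupType) (C : finSkewBrace)
  (p_prime : prime p) (q_prime : prime q)
  (q_dvd : q %| (p ^ p - 1) %/ (p - 1))
  (C_byott : byott_simple p q N R C) :
  exists B : nat -> finSkewBrace,
    (forall m : nat,
       [/\ simple_brace (B m),
           ([set: addG (B m)] \isog [set: dirpow N (p ^ m)])%g
         & solvable [set: circG (B m)]]) /\
    (forall m : nat, embeds_diagonally p (B m) (B m.+1)).
Proof.
(* Writing p as a successor gives ['I_p] its group structure. *)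
case: p p_prime q_dvd C_byott => [//|n] p_prime q_dvd C_byott.
have [d dM d_surj] := byott_simple_degree p_prime q_prime C_byott.
(* The tower starts at [C], graded by [d], and each level is the twisted power of the one before. *)
pose B m : gradedBrace n := iter m (@gtpower n) (GradedBrace dM).
have B_surj m : forall k, exists a : B m, gb_deg a = k.
  by elim: m => [//|m IHm]; apply: tdeg_surj.
have B_centerless m : centerless (B m).
  elim: m => [|m IHm]; last exact: tpower_centerless.
  exact: byott_simple_centerless C_byott.
have [[C_simple _] C_isog _ _ _] := C_byott.
exists B; split=> m; last exact: embeds_tpower.
split.
- by elim: m => [//|m IHm]; apply: tpower_simple.
- elim: m => [|m IHm].
    change ([set: addG C] \isog [set: dirpow N 1])%g.
    by rewrite (isog_transl _ C_isog) dirpow1_isog.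
  apply: isog_trans (addG_tpower_isog _) _.
  apply: isog_trans (dirpow_isog n.+1 IHm) _.
  by rewrite expnS dirpow_dirpow_isog.
elim: m => [|m IHm]; last exact: tpower_solvable.
exact: byott_simple_solvable C_byott.
Qed.
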